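(* For $k = 1,\dots,m$ let $I_k = \{i \in I : H_i^k \neq 0\}$ and let $[H_i]_{i \in I_k}$ be the submatrix of $H = [H_1, H_2, \dots, H_{|I|}]$ formed by the columns (all $m$ rows) belonging to the subsystems $i \in I_k$. Let $\rho \in \mathbb{R}^m$ be given by $$\rho^k = \mathrm{rank}\big([H_i]_{i \in I_k}\big) \cdot \max_{i \in I_k} \Big( \max_{x_i \in X_i} H_i^k x_i - \min_{x_i \in X_i} H_i^k x_i \Big), \qquad k = 1,\dots,m$$ (with $\rho^k = 0$ if $I_k = \emptyset$), and let $\bar b = b - \rho$. Assume that the programs $\overline{\mathcal{P}}_{\mathrm{LP}}$ and $\overline{\mathcal{D}}$ (the convexified program and the dual program with resource vector $\bar b$) each have a unique optimal solution, and let $\bar\lambda^\star$ be the optimal solution of $\overline{\mathcal{D}}$. Then any selection $x(\bar\lambda^\star) \in \mathcal{X}(\bar\lambda^\star)$ is feasible for $\mathcal{P}$, i.e. $x_i(\bar\lambda^\star) \in X_i$ for all $i\in I$ and $\sum_{i \in I} H_i x_i(\bar\lambda^\star) \preceq b$.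
   Context: Let $I$ be a finite index set and $m$ a positive integer with $|I| > m$. For each $i \in I$ let $r_i, z_i$ be nonnegative integers, $n_i = r_i + z_i$, $c_i \in \mathbb{R}^{n_i}$, $H_i \in \mathbb{R}^{m \times n_i}$, and let $X_i = \{x \in \mathbb{R}^{r_i} \times \mathbb{Z}^{z_i} : A_i x \preceq d_i\}$ (with $A_i \in \mathbb{R}^{m_i \times n_i}$, $d_i \in \mathbb{R}^{m_i}$) be non-empty and compact. Let $b \in \mathbb{R}^m$. Inequalities $\preceq, \succeq$ between vectors are componentwise; $H_i^k$ is the $k$-th row of $H_i$. The mixed-integer program $\mathcal{P}$ is: minimize $\sum_{i\in I} c_i^\top x_i$ subject to $\sum_{i \in I} H_i x_i \preceq b$ and $x_i \in X_i$ for all $i \in I$; it is assumed to be feasible. The program $\overline{\mathcal{P}}_{\mathrm{LP}}$ is: minimize $\sum_{i\in I} c_i^\top x_i$ subject to $\sum_{i \in I} H_i x_i \preceq \bar b$ and $x_i \in \mathrm{conv}(X_i)$ for all $i \in I$. The dual problem $\overline{\mathcal{D}}$ is: maximize over $\lambda \in \mathbb{R}^m$, $\lambda \succeq 0$, the function $-\lambda^\top \bar b + \sum_{i \in I} \min_{x_i \in X_i} (c_i^\top x_i + \lambda^\top H_i x_i)$. Let $\mathrm{vert}(X_i)$ denote the set of vertices of $\mathrm{conv}(X_i)$. For $\lambda \succeq 0$ put $\mathcal{X}_i(\lambda) = \mathrm{vert}(X_i) \cap \arg\min_{x_i \in X_i} (c_i^\top x_i + \lambda^\top H_i x_i)$ and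 $\mathcal{X}(\lambda) = \prod_{i\in I} \mathcal{X}_i(\lambda)$; a selection $x(\lambda) = (x_i(\lambda))_{i \in I}$ is any element of $\mathcal{X}(\lambda)$. *)

(* Defs.v *)
From HB Require Import structures.
From mathcomp Require Import all_boot all_order all_algebra.
From mathcomp Require Import all_classical all_reals all_analysis.
Export numFieldNormedType.Exports.

Set Implicit Arguments.
Unset Strict Implicit.
Unset Printing Implicit Defensive.

Import Order.TTheory GRing.Theory Num.Theory.
Local Open Scope classical_set_scope.
Local Open Scope ring_scope.

Section Geometry.
Variable R : realType.

Definition vle m (u v : 'cV[R]_m) : Prop := forall k, u k 0 <= v k 0.

Definition dot n (u v : 'cV[R]_n) : R := (u^T *m v) 0 0.

(* {x in R^r x Z^z | A x <= d}: the last z coordinates are the integer ones. *)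
Definition mixed_int_polyhedron p r z (A : 'M[R]_(p, r + z)) (d : 'cV[R]_p) :
    set 'cV[R]_(r + z) :=
  [set x | (forall j : 'I_z, dsubmx x j 0 \is a Num.int) /\ vle (A *m x) d].

Definition conv n (X : set 'cV[R]_n) : set 'cV[R]_n :=
  smallest (@convex_set R 'cV[R]_n) X.

Definition extreme_points n (C : set 'cV[R]_n) : set 'cV[R]_n :=
  [set x | C x /\
    forall (y w : 'cV[R]_n) (t : R), C y -> C w -> 0 < t < 1 ->
      x = t *: y + (1 - t) *: w -> y = x /\ w = x].

Definition vert n (X : set 'cV[R]_n) : set 'cV[R]_n := extreme_points (conv X).

Definition argmin (T : Type) (f : T -> R) (X : set T) : set T :=
  [set x | X x /\ forall y, X y -> f x <= f y].

(* Used only for linear f and X nonempty compact, where the bounds exist and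
   are attained. *)
Definition minval (T : Type) (f : T -> R) (X : set T) : R := inf (f @` X).
Definition maxval (T : Type) (f : T -> R) (X : set T) : R := sup (f @` X).

End Geometry.

Section Program.
Variables (R : realType) (I : finType) (m : nat) (n : I -> nat).
Variables (c : forall i, 'cV[R]_(n i)) (H : forall i, 'M[R]_(m, n i)).

Definition cost (x : forall i, 'cV[R]_(n i)) : R := \sum_i dot (c i) (x i).

(* With S := X this is feasibility for P, with S := conv X for P_LP. *)
Definition feasible (rhs : 'cV[R]_m) (S : forall i, set 'cV[R]_(n i)) :
    set (forall i, 'cV[R]_(n i)) :=
  [set x | (forall i, S i (x i)) /\ vle (\sum_i H i *m x i) rhs].

Variable X : forall i, set 'cV[R]_(n i).
Arguments X i : clear implicits.

Definition lp_optimal (rhs : 'cV[R]_m) : set (forall i, 'cV[R]_(n i)) :=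
  argmin cost (feasible rhs (fun i => conv (X i))).

Definition lagrangian (lambda : 'cV[R]_m) (i : I) (x : 'cV[R]_(n i)) : R :=
  dot (c i) x + dot lambda (H i *m x).

Definition dual_function (rhs lambda : 'cV[R]_m) : R :=
  - dot lambda rhs + \sum_i minval (@lagrangian lambda i) (X i).

Definition dual_optimal (rhs : 'cV[R]_m) : set 'cV[R]_m :=
  [set lambda | vle 0 lambda /\
    forall mu, vle 0 mu -> dual_function rhs mu <= dual_function rhs lambda].

Definition selections (lambda : 'cV[R]_m) : set (forall i, 'cV[R]_(n i)) :=
  [set x | forall i,
    (vert (X i) `&` argmin (@lagrangian lambda i) (X i)) (x i)].

Definition coupled (k : 'I_m) : {set I} := [set i | row k (H i) != 0]%SET.

Definition submatrix_of (J : {set I}) :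
    'M[R]_(m, \sum_(j < #|J|) n (enum_val j)) :=
  \mxrow_(j < #|J|) H (enum_val j).

Definition spread (k : 'I_m) (i : I) : R :=
  maxval (fun x => (H i *m x) k 0) (X i) -
  minval (fun x => (H i *m x) k 0) (X i).

(* Spreads are nonnegative, so 0 is a neutral initial value for the maximum;
   for empty I_k it yields the convention rho^k = 0. *)
Definition rho : 'cV[R]_m :=
  \col_k ((\rank (submatrix_of (coupled k)))%:R *
          \big[Num.max/0]_(i in coupled k) spread k i).

End Program.

(* Main.v *)
Require Import Defs.
From HB Require Import structures.
From mathcomp Require Import all_boot all_order all_algebra.
From mathcomp Require Import all_classical all_reals all_analysis.
From mathcomp Require Import lra ring.

Set Implicit Arguments.
Unset Strict Implicit.
Unset Printing Implicit Defensive.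

Import Order.TTheory GRing.Theory Num.Theory.
Local Open Scope classical_set_scope.
Local Open Scope ring_scope.

(** Write [L i] for the Lagrangian term of subsystem [i] at the dual optimum
[lambda], [F i] for the set of its minimizers over [conv (X i)], and let [y] be
a selection, so that [y i] lies in [F i].  The proof compares [y] with an
optimal point [x] of the convexified program chosen so that each [x i] lies in
[F i] and the segment from [y i] to [x i] can be prolonged beyond [x i] inside
[F i].

Such an [x] exists because the dual optimum is unique.  Each [X i] has a finite
test set on which every linear function attains its minimum over [X i]
([linear_test_set_mixed_int]), so the dual function is piecewise linear and has
a strictly negative slope at [lambda] along every nonzero direction that keeps
[lambda] nonnegative.  Read as a statement about selections
([descent_selection]), this is the hypothesis of Farkas' lemma, which returns a
convex combination of selections that gives positive weight to [y], is feasible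
and satisfies complementary slackness ([complementary_point]).  Lagrangian
sufficiency makes it optimal ([lagrangian_lp_optimal]).

Since the primal optimum is unique, the nonzero vectors among the
[H i *m (y i - x i)] are those with [y i != x i], and they are linearly
independent: a dependency would allow [x] to be moved inside the sets [F i]
without changing the resource consumption, hence without losing optimality
([independent_deviations]).  For the [k]-th resource, the vectors with [i] in
[I_k] lie in the column space of the submatrix of these subsystems, so at most
its rank many of them deviate ([card_le_rank_submatrix]).  Each deviation
changes the consumption of resource [k] by at most the spread of [i], and the
total change is at most [rho k], the amount by which the resource had been
tightened. *)

(** * The dot product *)

Section Dot.
Variable R : realType.

Lemma dotE n (u v : 'cV[R]_n) : dot u v = \sum_k u k 0 * v k 0.
Proof. by rewrite /dot mxE; apply: eq_bigr => k _; rewrite mxE. Qed.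

Lemma dotC n (u v : 'cV[R]_n) : dot u v = dot v u.
Proof. by rewrite !dotE; apply: eq_bigr => k _; rewrite mulrC. Qed.

Lemma dotDr n (u v w : 'cV[R]_n) : dot u (v + w) = dot u v + dot u w.
Proof. by rewrite /dot mulmxDr mxE. Qed.

Lemma dotZr n a (u v : 'cV[R]_n) : dot u (a *: v) = a * dot u v.
Proof. by rewrite /dot -scalemxAr mxE. Qed.

Lemma dotNr n (u v : 'cV[R]_n) : dot u (- v) = - dot u v.
Proof. by rewrite -scaleN1r dotZr mulN1r. Qed.

Lemma dotBr n (u v w : 'cV[R]_n) : dot u (v - w) = dot u v - dot u w.
Proof. by rewrite dotDr dotNr. Qed.

Lemma dot0r n (u : 'cV[R]_n) : dot u 0 = 0.
Proof. by rewrite /dot mulmx0 mxE. Qed.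

Lemma dotDl n (u v w : 'cV[R]_n) : dot (u + v) w = dot u w + dot v w.
Proof. by rewrite !(dotC _ w) dotDr. Qed.

Lemma dotZl n a (u v : 'cV[R]_n) : dot (a *: u) v = a * dot u v.
Proof. by rewrite !(dotC _ v) dotZr. Qed.

Lemma dot_sumr n (J : Type) (s : seq J) (P : pred J) (u : 'cV[R]_n) v :
  dot u (\sum_(j <- s | P j) v j) = \sum_(j <- s | P j) dot u (v j).
Proof. by rewrite /dot mulmx_sumr summxE. Qed.

Lemma dot_mulmx m n (u : 'cV[R]_m) (M : 'M[R]_(m, n)) v :
  dot u (M *m v) = dot (M^T *m u) v.
Proof. by rewrite /dot trmx_mul trmxK mulmxA. Qed.

Lemma dot_delta n (k : 'I_n) (v : 'cV[R]_n) : dot (delta_mx k 0) v = v k 0.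
Proof.
rewrite dotE (bigD1 k) //= big1 ?addr0 ?mxE ?eqxx ?mul1r // => j /negPf jk.
by rewrite mxE jk mul0r.
Qed.

Lemma dot_ge0_eq0 n (u : 'cV[R]_n) : (forall x, 0 <= dot u x) -> u = 0.
Proof.
move=> u0; apply/colP => k; rewrite mxE.
have := u0 (delta_mx k 0); have := u0 (- delta_mx k 0).
by rewrite dotNr (dotC u) dot_delta; lra.
Qed.

Lemma dot_continuous n (u : 'cV[R]_n) : continuous (dot u).
Proof.
have -> : dot u = fun v : 'cV[R]_n => \sum_k u k 0 * v k 0.
  by apply/funext => v; rewrite dotE.
move=> x; have nx := nbhs_filter x.
apply: (cvg_big (@pseudometric_normed_Zmodule.add_continuous R R^o)) => k _.
by apply: cvgM; [exact: cvg_cst|exact: coord_continuous].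
Qed.

(** Finitely many strict inequalities survive a small step.  The bound is given
for all smaller steps so that two families can be treated together. *)
Lemma small_step (T : eqType) (s : seq T) (B e : T -> R) :
  (forall j, j \in s -> 0 < e j) ->
  exists2 t, 0 < t &
    forall t', 0 < t' <= t -> forall j, j \in s -> t' * B j < e j.
Proof.
elim: s => [|j s IH] es; first by exists 1.
have [k ks|t t0 ts] := IH; first by apply: es; rewrite inE ks orbT.
have ej : 0 < e j by apply: es; rewrite mem_head.
have Bj : 0 < `|B j| + 1 by rewrite ltr_wpDl.
exists (Num.min t (e j / (`|B j| + 1))); first by rewrite lt_min t0 divr_gt0.
move=> t' /andP[t'0]; rewrite le_min => /andP[t't].
rewrite ler_pdivlMr // => t'B k; rewrite inE => /orP[/eqP ->|]; last first.
  by apply: ts; rewrite t'0.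
apply: lt_le_trans t'B; rewrite ltr_pM2l //.
by rewrite (le_lt_trans (ler_norm _)) ?ltrDl.
Qed.

(** * Farkas' lemma *)

(** Induction on the number of generators.  If the implication already holds
without the generator [a ord0], it contributes with coefficient zero.  Otherwise
some point satisfies all the other inequalities but not the conclusion, so
[a ord0] is negative there.  Adding multiples of this point projects the space
onto the kernel of [a ord0], where the remaining generators suffice. *)
Lemma farkas m n (a : 'I_n -> 'cV[R]_m) b :
  (forall x, (forall i, 0 <= dot (a i) x) -> 0 <= dot b x) ->
  exists2 q : 'I_n -> R, (forall i, 0 <= q i) & b = \sum_i q i *: a i.
Proof.
elim: n => [|n IH] in a b *.
  move=> ab; exists (fun=> 0) => //; rewrite big_ord0.
  by apply: dot_ge0_eq0 => x; apply: ab => -[].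
move=> ab; pose a' i := a (lift ord0 i).
have [a'b|] := pselect
  (forall x, (forall i, 0 <= dot (a' i) x) -> 0 <= dot b x).
  have [q q0 bq] := IH _ _ a'b.
  exists (fun i => oapp q 0 (unlift ord0 i)).
    by move=> i; case: unlift => //= j.
  rewrite big_ord_recl unlift_none scale0r add0r bq.
  by apply: eq_bigr => i _; rewrite liftK.
move=> /existsNP[x1 /not_implyP[a'x1 /negP]]; rewrite -ltNge => bx1.
have a0x1 : dot (a ord0) x1 < 0.
  rewrite ltNge; apply/negP => a0; suff : 0 <= dot b x1 by rewrite leNgt bx1.
  by apply: ab => i; case: (unliftP ord0 i) => [j|] -> //; exact: a'x1.
(* Normalized so that [x + dot (a ord0) x *: xb] is orthogonal to [a ord0]. *)
pose xb := (- dot (a ord0) x1)^-1 *: x1.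
have s0 : 0 < (- dot (a ord0) x1)^-1 by rewrite invr_gt0 oppr_gt0.
have a0xb : dot (a ord0) xb = -1.
  by rewrite dotZr; field; rewrite lt_eqF.
have bxb : dot b xb < 0 by rewrite dotZr pmulr_rlt0.
have a'xb i : 0 <= dot (a' i) xb by rewrite dotZr mulr_ge0 ?a'x1 // ltW.
clearbody xb.
have [x a''x|q q0 bq] :=
    IH (fun i => a' i + dot (a' i) xb *: a ord0) (b + dot b xb *: a ord0).
  have : 0 <= dot b (x + dot (a ord0) x *: xb).
    apply: ab => i; case: (unliftP ord0 i) => [j|] ->.
      have := a''x j.
      by rewrite dotDl dotZl dotDr dotZr (mulrC (dot (a ord0) x)).
    by rewrite dotDr dotZr a0xb mulrN1 subrr.
  by rewrite dotDl dotZl dotDr dotZr (mulrC (dot (a ord0) x)).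
pose q1 := \sum_i q i * dot (a' i) xb - dot b xb.
exists (fun i => oapp q q1 (unlift ord0 i)).
  move=> i; case: unlift => //=; rewrite /q1 subr_ge0.
  by apply: le_trans (ltW bxb) _; apply: sumr_ge0 => j _; rewrite mulr_ge0.
apply: (addIr (dot b xb *: a ord0)); rewrite {1}bq big_ord_recl unlift_none /=.
under [in RHS]eq_bigr do rewrite liftK /=.
rewrite [RHS]addrAC -scalerDl /q1 subrK scaler_suml -big_split /=.
by apply: eq_bigr => i _; rewrite scalerDr scalerA addrC.
Qed.

Lemma farkas_fin m (T : finType) (a : T -> 'cV[R]_m) b :
  (forall x, (forall i, 0 <= dot (a i) x) -> 0 <= dot b x) ->
  exists2 q : T -> R, (forall i, 0 <= q i) & b = \sum_i q i *: a i.
Proof.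
move=> ab; have [x ax|q q0 ->] := @farkas m #|T| (a \o enum_val) b.
  by apply: ab => i; rewrite -[i]enum_rankK; exact: ax.
exists (q \o enum_rank) => [i|]; first exact: q0.
rewrite (reindex (@enum_rank T)) /=.
  by apply: eq_bigr => i _; rewrite enum_rankK.
exact: onW_bij (@enum_rank_bij T).
Qed.

End Dot.

(** * Convex hulls *)

Section ConvexHull.
Variables (R : realType) (n : nat).
Implicit Types (X C : set 'cV[R]_n) (x y a : 'cV[R]_n).

(** Restates [convex_set] with plain membership and a plain real parameter. *)
Definition convex C := forall x y t,
  C x -> C y -> 0 <= t <= 1 -> C (t *: x + (1 - t) *: y).

Lemma convexE C : convex C <-> @convex_set R 'cV[R]_n C.
Proof.
split=> [cC x y t /[!inE] Cx Cy|cC x y t Cx Cy /andP[t0 t1]].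
  by apply: cC => //; rewrite ge0 le1.
by have := cC x y (Itv01 t0 t1); rewrite !inE; exact.
Qed.

Lemma sub_conv X : X `<=` Defs.conv X.
Proof. exact: sub_gen_smallest. Qed.

Lemma conv_sub X C : convex C -> X `<=` C -> Defs.conv X `<=` C.
Proof. by move=> /convexE; exact: smallest_sub. Qed.

Lemma conv_convex X : convex (Defs.conv X).
Proof.
move=> x y t cx cy t01 C CX; have [/convexE cC _] := CX.
by apply: cC => //; [exact: cx|exact: cy].
Qed.

Lemma convex_dot_ge a M : convex [set x | M <= dot a x].
Proof.
move=> x y t /= Mx My /andP[t0 t1]; rewrite dotDr !dotZr.
have := ler_wpM2l t0 Mx; have : 0 <= 1 - t by lra.
by move=> s0; have := ler_wpM2l s0 My; lra.
Qed.

Lemma convex_dot_eq a M : convex [set x | dot a x = M].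
Proof. by move=> x y t /= xM yM _; rewrite dotDr !dotZr xM yM; ring. Qed.

Lemma convexI C D : convex C -> convex D -> convex (C `&` D).
Proof.
by move=> cC cD x y t [Cx Dx] [Cy Dy] t01; split; [exact: cC|exact: cD].
Qed.

(** The conic form, with weights that need not sum to one, is the one preserved
when an element is added to [s], also if the total weight of [s] is zero. *)
Lemma convex_sum (T : Type) (s : seq T) C (q : T -> R) (w : T -> 'cV[R]_n) :
  convex C -> C !=set0 -> (forall j, 0 <= q j) -> (forall j, C (w j)) ->
  exists2 x, C x & \sum_(j <- s) q j *: w j = (\sum_(j <- s) q j) *: x.
Proof.
move=> cC [x0 Cx0] q0 Cw; elim: s => [|j s [x Cx IH]].
  by exists x0; rewrite // !big_nil scale0r.
rewrite !big_cons IH; set Q := \sum_(_ <- _) _.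
have Q0 : 0 <= Q by apply: sumr_ge0.
have [qQ0|qQ] := eqVneq (q j + Q) 0.
  exists x => //; have [-> ->] : q j = 0 /\ Q = 0 by have := q0 j; lra.
  by rewrite addr0 !scale0r addr0.
exists (q j / (q j + Q) *: w j + (1 - q j / (q j + Q)) *: x).
  have qQ1 : 0 < q j + Q by rewrite lt_neqAle eq_sym qQ addr_ge0.
  apply: cC => //; rewrite divr_ge0 ?addr_ge0 //= ler_pdivrMr // mul1r.
  by rewrite lerDl.
by rewrite scalerDr !scalerA; congr (_ *: _ + _ *: _); field.
Qed.

End ConvexHull.

(** * Finite test sets of mixed-integer polyhedra *)

Section FiniteTestSet.
Variable R : realType.

(** Plays the part of the finite vertex set of [conv X]: the dual function
depends on [X] only through the values of linear functions on [V]. *)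
Definition linear_test_set n (V : seq 'cV[R]_n) (X : set 'cV[R]_n) :=
  (forall v, v \in V -> X v) /\
  forall a, exists2 v, v \in V & argmin (dot a) X v.

Lemma compact_argmin_dot n (X : set 'cV[R]_n) a :
  X !=set0 -> compact X -> argmin (dot a) X !=set0.
Proof.
move=> X0 cX; have [|x Xx xmin] := @compact_EVT_min _ R (dot a) X X0 cX.
  exact/continuous_subspaceT/dot_continuous.
by exists x; split; [rewrite inE in Xx|move=> y Xy; apply: xmin; rewrite inE].
Qed.

(** Two points with the same active constraints and the same integer part lie in
the relative interior of a common face of a common continuous slice, so a linear
function minimal at one is minimal at the other.  Concretely, [x] can be moved a
little away from [y] inside [X]; minimality of [x] along this step says that
the function is not larger at [y]. *)
Lemma mixed_int_argmin p r z (A : 'M[R]_(p, r + z)) (d : 'cV[R]_p) a x y :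
  let X := mixed_int_polyhedron A d in
  argmin (dot a) X x -> X y ->
  (forall j, ((A *m x) j 0 == d j 0) = ((A *m y) j 0 == d j 0)) ->
  (forall j, dsubmx x j 0 = dsubmx y j 0) ->
  argmin (dot a) X y.
Proof.
move=> X [[xint xA] xmin] Xy; have [yint yA] := Xy => act int.
have [|t t0 ts] := @small_step R _ [seq j <- enum 'I_p | (A *m x) j 0 != d j 0]
  (fun j => (A *m x) j 0 - (A *m y) j 0) (fun j => d j 0 - (A *m x) j 0).
  by move=> j; rewrite mem_filter subr_gt0 lt_neqAle xA => /andP[-> _].
split => // w Xw; apply: le_trans (xmin _ Xw).
have : X (x + t *: (x - y)).
  split=> [j|j].
    have := xint j; move: (int j); rewrite !mxE => <-.
    by rewrite subrr mulr0 addr0.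
  rewrite mulmxDr -scalemxAr mulmxBr !mxE.
  have [xd|xd] := boolP ((A *m x) j 0 == d j 0).
    have /eqP := xd; have := xd; rewrite act => /eqP.
    by rewrite !mxE => -> ->; rewrite subrr mulr0 addr0.
  have := ts t _ j; rewrite t0 lexx mem_filter xd mem_enum => /(_ isT isT).
  by rewrite !mxE; lra.
by move=> /xmin; rewrite dotDr dotZr dotBr lerDl pmulr_rge0 // subr_ge0.
Qed.

(** By compactness the integer parts are bounded, so there are finitely many
pairs of an active set and an integer part.  One representative for each pair
that occurs is enough by [mixed_int_argmin]. *)
Lemma linear_test_set_mixed_int p r z (A : 'M[R]_(p, r + z)) (d : 'cV[R]_p) :
  let X := mixed_int_polyhedron A d in
  X !=set0 -> compact X -> exists V, linear_test_set V X.
Proof.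
move=> X X0 cX; have [x0 Xx0] := X0.
(* [B j] bounds the [j]-th integer coordinate on [X]. *)
have /choice[B XB] (j : 'I_z) : exists N : nat, forall x, X x ->
    `|dsubmx x j 0| < N%:R.
  have dj x : dsubmx x j 0 = dot (delta_mx (rshift r j) 0) x.
    by rewrite dot_delta !mxE.
  have [u [_ umin]] := compact_argmin_dot (delta_mx (rshift r j) 0) X0 cX.
  have [w [_ wmin]] := compact_argmin_dot (- delta_mx (rshift r j) 0) X0 cX.
  set L := dot _ u in umin; set W := dot _ w in wmin.
  exists (Num.bound (`|L| + `|W|)) => x Xx.
  apply: (@le_lt_trans _ _ (`|L| + `|W|)); last first.
    by rewrite archi_boundP // addr_ge0.
  move: (umin _ Xx) (wmin _ Xx); rewrite (dotC (- _)) dotNr (dotC x) -dj.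
  have := ler_norm (- L); have := ler_norm (- W).
  rewrite !normrN => hW hL h1 h2.
  have := normr_ge0 L; have := normr_ge0 W.
  by rewrite ler_norml; move=> *; apply/andP; split; lra.
pose N := \max_j B j.
(* Shifting by [N] makes the bounded integers natural numbers. *)
pose code (t : R) : 'I_(N + N).+1 := inord `|Num.floor (t + N%:R)|%N.
pose key (x : 'cV[R]_(r + z)) :=
  ([ffun j => (A *m x) j 0 == d j 0], [ffun j => code (dsubmx x j 0)]).
have codeK x y j : X x -> X y -> code (dsubmx x j 0) = code (dsubmx y j 0) ->
    dsubmx x j 0 = dsubmx y j 0.
  have aux w : X w -> let s := dsubmx w j 0 in
      let f := `|Num.floor (s + N%:R)|%N in
      (f < (N + N).+1)%N /\ s = f%:R - N%:R.
    move=> Xw s f.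
    have sint : s + N%:R \is a Num.int.
      by rewrite rpredD ?rpred_nat // (Xw.1 j).
    have : `|s| < N%:R.
      by apply: lt_le_trans (XB j _ Xw) _; rewrite ler_nat leq_bigmax.
    rewrite ltr_norml => /andP[sN Ns].
    have s0 : 0 <= s + N%:R by lra.
    have f0 : 0 <= Num.floor (s + N%:R) by rewrite floor_ge0.
    have fE : f%:R = s + N%:R by rewrite natr_absz ger0_norm // floorK.
    split; last by rewrite fE addrK.
    by rewrite ltnS -(ler_nat R) fE natrD; lra.
  move=> Xx Xy /(congr1 (@nat_of_ord _)).
  have [xN xE] := aux _ Xx; have [yN yE] := aux _ Xy.
  by rewrite /code !inordK // => e; rewrite xE yE e.
pose rep k := xget x0 [set x | X x /\ key x = k].
have repX x : X x -> X (rep (key x)) /\ key (rep (key x)) = key x.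
  by move=> Xx; rewrite /rep; case: xgetP => [w -> []//|/(_ x)]; case; split.
exists [seq rep k | k <- enum {: _}]; split=> [_ /mapP[k _ ->]|a].
  by rewrite /rep; case: xgetP => [w _ []|].
have [x xmin] := compact_argmin_dot a X0 cX.
have [Xr rx] := repX x xmin.1.
exists (rep (key x)); first by apply: map_f; rewrite mem_enum.
case: rx => act int; apply: (mixed_int_argmin xmin Xr) => j.
  by move/ffunP/(_ j): act; rewrite !ffunE.
move/ffunP/(_ j): int; rewrite !ffunE => /esym.
exact: (codeK _ _ _ xmin.1 Xr).
Qed.

End FiniteTestSet.

(** * Extreme values of linear functions *)

Section Bounds.
Variables (R : realType) (n : nat) (X : set 'cV[R]_n) (V : seq 'cV[R]_n).
Hypothesis VX : linear_test_set V X.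

Lemma minval_argmin (T : Type) (f : T -> R) (Y : set T) x :
  argmin f Y x -> minval f Y = f x.
Proof.
move=> [Yx xmin]; apply/eqP; rewrite eq_le; apply/andP; split.
  by apply: ge_inf; [exists (f x) => _ [y /xmin ? <-]|exists x].
by apply: lb_le_inf; [exists (f x), x|move=> _ [y /xmin ? <-]].
Qed.

Lemma argmin_conv_le a x z :
  argmin (dot a) X x -> Defs.conv X z -> dot a x <= dot a z.
Proof.
by move=> [_ xmin]; exact: (conv_sub (@convex_dot_ge _ _ a (dot a x)) xmin).
Qed.

Lemma dot_diff_le_spread a x z : X x -> Defs.conv X z ->
  dot a x - dot a z <= maxval (dot a) X - minval (dot a) X.
Proof.
move=> Xx Xz; have [v _ vmin] := VX.2 a; have [w _ [_ wmin]] := VX.2 (- a).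
have := argmin_conv_le vmin Xz; rewrite (minval_argmin vmin) => vz.
apply: lerB => //; apply: ub_le_sup; last by exists x.
exists (dot a w) => _ [u /wmin + <-].
by rewrite !(dotC (- a)) !dotNr lerN2 !(dotC _ a).
Qed.

End Bounds.

(** * Rank of the matrix of coupled subsystems *)

Section RankBound.
Variables (R : realType) (I : finType) (m : nat) (n : I -> nat).
Variable H : forall i, 'M[R]_(m, n i).

(** Independent vectors [H i *m u i] with [i] in [S] all lie in the column space
of the submatrix of [S]. *)
Lemma card_le_rank_submatrix (u : forall i, 'cV[R]_(n i)) (J S : {set I}) :
  J \subset S ->
  (forall q : I -> R, \sum_(i in J) q i *: (H i *m u i) = 0 ->
    forall i, i \in J -> q i = 0) ->
  (#|J| <= \rank (submatrix_of H S))%N.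
Proof.
move=> JS indep.
pose U : 'M[R]_(#|J|, m) :=
  \matrix_(j, k) (H (enum_val j) *m u (enum_val j)) k 0.
have freeU : row_free U.
  apply: inj_row_free => v vU; apply/rowP => j; rewrite mxE.
  pose q i : R := \sum_l v 0 l *+ (enum_val l == i).
  have qE l : q (enum_val l) = v 0 l.
    rewrite /q (bigD1 l) //= eqxx big1 ?addr0 // => h /negPf hl.
    by rewrite (inj_eq enum_val_inj) hl.
  rewrite -qE; apply: indep; last exact: enum_valP.
  rewrite big_enum_val /=; apply/colP => k.
  have /rowP/(_ k) := vU; rewrite !mxE => <-; rewrite summxE.
  by apply: eq_bigr => l _; rewrite qE !mxE.
(* Column [j] of [Z] holds [u i] in the block of the [j]-th element [i] of [J]
   and zeros elsewhere, so that the product picks out [H i *m u i]. *)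
pose Z : 'M[R]_(_, #|J|) := \mxcol_(l < #|S|)
  \matrix_(a, j) (u (enum_val l) a 0 *+ (enum_val l == enum_val j)).
have -> : #|J| = \rank U^T by rewrite mxrank_tr; apply/esym/eqP.
suff -> : U^T = submatrix_of H S *m Z by exact: mxrankM_maxl.
rewrite mul_mxrow_mxcol; apply/matrixP => k j; rewrite summxE mxE mxE.
pose F i : R := (H i *m (\matrix_(a < n i, j < #|J|)
  (u i a 0 *+ (i == enum_val j)))) k j.
rewrite -(big_enum_val F) /F (bigD1 (enum_val j)) /=; last first.
  by apply: (fintype.subsetP JS); exact: enum_valP.
rewrite big1 ?addr0 => [|i /andP[_ /negPf ij]]; rewrite !mxE.
  by apply: eq_bigr => a _; rewrite mxE eqxx.
by rewrite big1 // => a _; rewrite mxE ij mulr0.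
Qed.

End RankBound.

(** * Lagrangian duality and uniqueness *)

Section Duality.
Variables (R : realType) (I : finType) (m : nat) (n : I -> nat).
Variables (c : forall i, 'cV[R]_(n i)) (H : forall i, 'M[R]_(m, n i)).
Variables (X : forall i, set 'cV[R]_(n i)) (V : forall i, seq 'cV[R]_(n i)).
Arguments X i : clear implicits.
Hypothesis VX : forall i, linear_test_set (V i) (X i).
Variables (rhs lambda : 'cV[R]_m).
Hypothesis lambda_opt : dual_optimal c H X rhs lambda.

Local Notation L mu i := (@lagrangian R I m n c H mu i).

Definition residual (x : forall i, 'cV[R]_(n i)) : 'cV[R]_m :=
  \sum_i H i *m x i - rhs.

Lemma lagrangianE mu i : L mu i = dot (c i + (H i)^T *m mu).
Proof. by apply/funext => x; rewrite /lagrangian dotDl dot_mulmx. Qed.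

Lemma lagrangianD mu t d i x :
  L (mu + t *: d) i x = L mu i x + t * dot d (H i *m x).
Proof. by rewrite /lagrangian dotDl dotZl addrA. Qed.

Lemma dual_functionE mu x : (forall i, argmin (L mu i) (X i) (x i)) ->
  dual_function c H X rhs mu = cost c x + dot mu (residual x).
Proof.
move=> xmin; rewrite /dual_function /residual dotBr dot_sumr /cost.
under eq_bigr do rewrite (minval_argmin (xmin _)) /lagrangian.
by rewrite big_split /=; ring.
Qed.

Lemma cost_lagrangian mu x :
  cost c x = \sum_i L mu i (x i) - dot mu (\sum_i H i *m x i).
Proof.
by rewrite dot_sumr -sumrB; apply: eq_bigr => i _; rewrite /lagrangian addrK.
Qed.

Variable y : forall i, 'cV[R]_(n i).
Hypothesis ymin : forall i, argmin (L lambda i) (X i) (y i).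

(** Lagrangian sufficiency: minimizing every Lagrangian term together with
feasibility and complementary slackness makes the cost of [x] equal to the dual
value, which is a lower bound for the cost of every feasible point. *)
Lemma lagrangian_lp_optimal x :
  (forall i, Defs.conv (X i) (x i) /\ L lambda i (x i) = L lambda i (y i)) ->
  (forall k, residual x k 0 <= 0) ->
  (forall k, lambda k 0 != 0 -> residual x k 0 = 0) ->
  lp_optimal c H X rhs x.
Proof.
move=> xC xfeas xcompl; split=> [|w [wC wfeas]].
  split=> [i|k]; first by have [] := xC i.
  by have := xfeas k; rewrite /residual !mxE subr_le0.
rewrite !(cost_lagrangian lambda); apply: lerB.
  apply: ler_sum => i _; rewrite (xC i).2; have := ymin i.
  by rewrite lagrangianE => /argmin_conv_le; exact.
have -> : dot lambda (\sum_i H i *m x i) = dot lambda rhs.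
  apply/eqP; rewrite -subr_eq0 -dotBr dotE big1 // => k _.
  have [->|/xcompl rk] := eqVneq (lambda k 0) 0; first by rewrite mul0r.
  by rewrite -/(residual x) rk mulr0.
rewrite !dotE; apply: ler_sum => k _; apply: ler_wpM2l (wfeas k).
by have := lambda_opt.1 k; rewrite mxE.
Qed.

Hypothesis lambda_unique : forall mu, dual_optimal c H X rhs mu -> mu = lambda.

(** Move from [lambda] to [lambda + t *: d].  For small [t] the minimizers in
the finite test sets are still minimizers at [lambda], because the others lose
by a fixed margin.  The dual function is therefore linear in this step with
slope [dot d (residual v)], and the slope is negative since [lambda] is the only
maximizer. *)
Lemma descent_selection (d : 'cV[R]_m) : d != 0 ->
  (forall k, lambda k 0 = 0 -> 0 <= d k 0) ->
  exists2 v : forall i, 'cV[R]_(n i),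
    forall i, v i \in V i /\ argmin (L lambda i) (X i) (v i) &
    dot d (residual v) < 0.
Proof.
move=> d0 dK; have lambda0 k : 0 <= lambda k 0.
  by have := lambda_opt.1 k; rewrite mxE.
pose T := {i : I & 'cV[R]_(n i)}.
pose s : seq T := [seq Tagged (fun i => 'cV[R]_(n i)) v | i <- enum I,
  v <- [seq v <- V i | L lambda i (y i) < L lambda i v]].
have [|t1 t10 ts1] := @small_step R T s
    (fun u => dot d (H (tag u) *m (y (tag u) - tagged u)))
    (fun u => L lambda (tag u) (tagged u) - L lambda (tag u) (y (tag u))).
  move=> _ /allpairsPdep[i [v [_ + ->]]] /=.
  by rewrite mem_filter subr_gt0 => /andP[].
have [|t2 t20 ts2] := @small_step R _ [seq k <- enum 'I_m | lambda k 0 != 0]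
    (fun k => - d k 0) (fun k => lambda k 0).
  by move=> k; rewrite mem_filter lt_neqAle eq_sym lambda0 => /andP[-> _].
pose t := Num.min t1 t2; have t0 : 0 < t by rewrite lt_min t10.
have mu0 : vle 0 (lambda + t *: d).
  move=> k; rewrite !mxE; have [lk|lk] := eqVneq (lambda k 0) 0.
    by rewrite lk add0r mulr_ge0 ?dK // ltW.
  have := ts2 t _ k; rewrite t0 ge_min lexx orbT mem_filter lk mem_enum.
  by move=> /(_ isT isT); lra.
have vP i : exists v, (v \in V i /\ argmin (L lambda i) (X i) v) /\
    argmin (L (lambda + t *: d) i) (X i) v.
  have [v Vv] := (VX i).2 (c i + (H i)^T *m (lambda + t *: d)).
  rewrite -lagrangianE => vmin; exists v; split=> //; split=> //.
  split=> [|w Xw]; first exact: vmin.1.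
  apply: le_trans ((ymin i).2 _ Xw); rewrite leNgt; apply/negP => yv.
  have us : Tagged (fun i => 'cV[R]_(n i)) v \in s.
    apply/allpairsPdep; exists i, v; split=> //; first by rewrite mem_enum.
    by rewrite mem_filter yv.
  have := ts1 t _ _ us; rewrite t0 ge_min lexx => /(_ isT) /=.
  have := vmin.2 _ (ymin i).1; rewrite !lagrangianD.
  by rewrite mulmxBr dotBr; lra.
pose v i := sval (cid (vP i)).
have vV i : v i \in V i /\ argmin (L lambda i) (X i) (v i).
  by rewrite /v; case: cid => ? [].
have vmin i : argmin (L (lambda + t *: d) i) (X i) (v i).
  by rewrite /v; case: cid => ? [].
exists v => //; rewrite ltNge; apply/negP => dv; move/eqP: d0; apply.
have : dual_optimal c H X rhs (lambda + t *: d).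
  split=> // mu /lambda_opt.2 /le_trans; apply.
  rewrite (dual_functionE vmin) (dual_functionE (fun i => (vV i).2)).
  by rewrite dotDl dotZl addrA lerDl mulr_ge0 // ltW.
move=> /lambda_unique/eqP; rewrite addrC -subr_eq0 addrK scaler_eq0.
by rewrite gt_eqF //= => /eqP.
Qed.

(** Farkas' lemma applied to the residuals of the finitely many selections taken
from the test sets, together with the unit vectors of the resources whose price
vanishes.  By [descent_selection] only the zero vector has nonnegative product
with all of them, so they generate every vector, in particular [- residual y].
Adding [residual y] and dividing by the total weight [1 + Q] gives the point,
in which [y] has weight [al = (1 + Q)^-1]. *)
Lemma complementary_point : exists al (z : forall i, 'cV[R]_(n i)),
  let x i := al *: y i + (1 - al) *: z i in
  [/\ 0 < al <= 1,
      forall i, Defs.conv (X i) (z i) /\ L lambda i (z i) = L lambda i (y i),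
      forall k, residual x k 0 <= 0 &
      forall k, lambda k 0 != 0 -> residual x k 0 = 0].
Proof.
(* Out of range indices give [y i], so that every [f] encodes a selection. *)
pose F i := [seq v <- V i | `[< argmin (L lambda i) (X i) v >] ].
pose N := \max_i size (F i).
pose w (f : {ffun I -> 'I_N.+1}) i := nth (y i) (F i) (f i).
have wmin f i : argmin (L lambda i) (X i) (w f i).
  rewrite /w; have [fi|fi] := ltnP (f i) (size (F i)); last first.
    by rewrite nth_default.
  by have := mem_nth (y i) fi; rewrite {2}/F mem_filter => /andP[/asboolP].
pose e k : 'cV[R]_m := if lambda k 0 == 0 then delta_mx k 0 else 0.
pose a (g : {ffun I -> 'I_N.+1} + 'I_m) : 'cV[R]_m :=
  match g with inl f => residual (w f) | inr k => e k end.
have [|q q0 qE] := @farkas_fin R m _ a (- residual y).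
  move=> d da; have [->|d0] := eqVneq d 0; first by rewrite dot0r.
  exfalso; have [k lk|v vV] := descent_selection d0.
    by have := da (inr k); rewrite /= /e lk eqxx dot_delta.
  apply/negP; rewrite -leNgt.
  have vF i : v i \in F i.
    by rewrite mem_filter (vV i).1 andbT; apply/asboolP/(vV i).2.
  have := da (inl [ffun i => inord (index (v i) (F i))]) => /=.
  set f := finfun _; suff -> : residual (w f) = residual v by rewrite dotC.
  congr (_ - _); apply: eq_bigr => i _.
  rewrite /w ffunE inordK ?nth_index ?vF //.
  by rewrite ltnS (leq_trans _ (leq_bigmax i)) // ltnW // index_mem vF.
pose Q := \sum_f q (inl f); have Q0 : 0 <= Q by apply: sumr_ge0.
have zP i : exists2 z, Defs.conv (X i) z /\ L lambda i z = L lambda i (y i) &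
    \sum_f q (inl f) *: w f i = Q *: z.
  apply: (@convex_sum _ _ _ _ (Defs.conv (X i) `&`
    [set z | L lambda i z = L lambda i (y i)])) => //.
  - apply: convexI; first exact: conv_convex.
    by rewrite lagrangianE; exact: convex_dot_eq.
  - by exists (y i); split=> //; apply: sub_conv; exact: (ymin i).1.
  - move=> f; have [Xw wle] := wmin f i; split; first exact: sub_conv.
    apply/eqP; rewrite eq_le (wle _ (ymin i).1) /=.
    exact: (ymin i).2.
pose z i := s2val (cid2 (zP i)); pose al := (1 + Q)^-1.
have Q1 : 0 < 1 + Q by lra.
exists al, z => x.
have rE : residual x = - al *: \sum_k q (inr k) *: e k.
  have zE : Q *: \sum_i H i *m z i =
      \sum_f q (inl f) *: residual (w f) + Q *: rhs.
    rewrite [X in _ = _ + X]scaler_suml -big_split /= scaler_sumr.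
    under [RHS]eq_bigr do rewrite -scalerDr subrK scaler_sumr.
    rewrite exchange_big /=; apply: eq_bigr => i _.
    rewrite scalemxAr /z; case: cid2 => zi /= _ <-; rewrite mulmx_sumr.
    by apply: eq_bigr => f _; rewrite scalemxAr.
  have xE : residual x = al *: \sum_i H i *m y i +
      (al * Q) *: \sum_i H i *m z i - rhs.
    congr (_ - _); rewrite !scaler_sumr -big_split /=; apply: eq_bigr => i _.
    rewrite mulmxDr !scalemxAr (_ : 1 - al = al * Q) //.
    by rewrite /al; field; rewrite gt_eqF.
  rewrite xE -scalerA zE; move: qE; rewrite big_sumType /=.
  set S := \sum_f _; set E := \sum_k _ => qE.
  have -> : S = - residual y - E by rewrite qE addrK.
  rewrite /residual; apply/colP => k; rewrite !mxE /al; field.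
  by rewrite gt_eqF.
have rk k : residual x k 0 = if lambda k 0 == 0 then - al * q (inr k) else 0.
  rewrite rE mxE summxE (bigD1 k) //= big1 ?addr0 => [|j jk].
    by rewrite mxE /e; case: ifP => _; rewrite !mxE ?eqxx ?mulr1 ?mulr0.
  rewrite mxE /e; case: ifP => _; rewrite !mxE ?mulr0 //.
  by rewrite eq_sym (negPf jk) mulr0.
have al0 : 0 < al by rewrite invr_gt0.
split=> [|i|k|k /negPf lk].
- by rewrite al0 invf_le1 // lerDl.
- by rewrite /z; case: cid2.
- by rewrite rk; case: ifP => // _; rewrite mulNr oppr_le0 mulr_ge0 // ltW.
- by rewrite rk lk.
Qed.

Hypothesis lp_unique :
  forall x x', lp_optimal c H X rhs x -> lp_optimal c H X rhs x' -> x = x'.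

(** The point [x] has positive weight [al] on [y], so [x i] may be moved along
[y i - x i] in both directions, by up to [al] times that vector, and still
minimize the Lagrangian term.  A linear dependency, scaled down to this range,
moves [x] without changing its residual; the moved point is again optimal and
must equal [x]. *)
Lemma independent_deviations : exists x : forall i, 'cV[R]_(n i),
  [/\ forall i, Defs.conv (X i) (x i),
      forall k, residual x k 0 <= 0 &
      forall q : I -> R, \sum_i q i *: (H i *m (y i - x i)) = 0 ->
        forall i, q i *: (y i - x i) = 0].
Proof.
have [al [z [/andP[al0 al1] zC xfeas xcompl]]] := complementary_point.
set x := fun i => _ in xfeas xcompl.
have segC i t : 0 <= t <= 1 ->
    Defs.conv (X i) (t *: y i + (1 - t) *: z i) /\
    L lambda i (t *: y i + (1 - t) *: z i) = L lambda i (y i).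
  move=> t01; have [zi Lzi] := zC i; split.
    by apply: conv_convex => //; apply: sub_conv; exact: (ymin i).1.
  by move: Lzi; rewrite lagrangianE dotDr !dotZr => ->; ring.
have al01 : 0 <= al <= 1 by rewrite ltW.
exists x; split=> // [i|q qdep i]; first exact: (segC i _ al01).1.
pose s := al / (1 + \sum_j `|q j|).
have q1 : 0 < 1 + \sum_j `|q j| by rewrite ltr_pwDl // sumr_ge0.
have s0 : 0 < s by rewrite divr_gt0.
pose x' j := x j + (s * q j) *: (y j - x j).
have x'E j : x' j =
    (al + s * q j * (1 - al)) *: y j + (1 - (al + s * q j * (1 - al))) *: z j.
  by rewrite /x' /x; apply/colP => k; rewrite !mxE; ring.
have sq j : `|s * q j| <= al.
  rewrite normrM gtr0_norm // /s mulrAC -mulrA ler_piMr ?(ltW al0) //.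
  rewrite ler_pdivrMr // mul1r (bigD1 j) //= addrCA lerDl.
  by rewrite addr_ge0 // sumr_ge0.
have rx' : residual x' = residual x.
  congr (_ - _); under eq_bigr do rewrite mulmxDr -scalemxAr.
  rewrite big_split /= -[RHS]addr0; congr (_ + _).
  under eq_bigr do rewrite -scalerA.
  by rewrite -scaler_sumr qdep scaler0.
have x'C j : Defs.conv (X j) (x' j) /\ L lambda j (x' j) = L lambda j (y j).
  rewrite x'E; apply: segC; have := sq j; rewrite ler_norml => /andP[lo hi].
  have h : 0 <= 1 - al by lra.
  have := ler_wpM2r h lo; have := ler_wpM2r h hi.
  have : 0 <= al * al by rewrite mulr_ge0 // ltW.
  have := ler_wpM2r h al1; move=> *; apply/andP; split; nra.
have /(congr1 (fun f => f i)) : x' = x.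
  apply: lp_unique; apply: lagrangian_lp_optimal; rewrite ?rx' // => j.
  exact: segC.
move/eqP; rewrite /x' addrC -subr_eq0 addrK -scalerA scaler_eq0 gt_eqF //=.
exact: eqP.
Qed.

(** Only coupled subsystems in which [y] and [x] differ contribute to the change
of the consumption of resource [k]; there are at most as many as the rank, and
each contributes at most its spread. *)
Lemma selection_residual_le k :
  residual y k 0 <= rho H X k 0.
Proof.
have [x [xC xfeas indep]] := independent_deviations.
pose u i := y i - x i.
pose J : {set I} := [set i in coupled H k | u i != 0]%SET.
have JS : J \subset coupled H k.
  by apply/fintype.subsetP => i; rewrite inE => /andP[].
have cardJ : (#|J| <= \rank (submatrix_of H (coupled H k)))%N.
  apply: (@card_le_rank_submatrix _ _ _ _ _ u _ _ JS) => q qdep i iJ.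
  have := indep (fun i => if i \in J then q i else 0).
  rewrite (eq_bigr (fun i => if i \in J then q i *: (H i *m u i) else 0)).
    rewrite -big_mkcond /= => /(_ qdep i); rewrite iJ => /eqP.
    rewrite scaler_eq0 => /orP[/eqP //|ui]; move: iJ.
    by rewrite inE /u (eqP ui) eqxx andbF.
  by move=> j _; case: ifP; rewrite // scale0r.
pose M := \big[Num.max/0]_(i in coupled H k) spread H X k i.
have M0 : 0 <= M by exact: bigmax_ge_id.
have -> : residual y k 0 = residual x k 0 + \sum_i (H i *m u i) k 0.
  rewrite /residual !mxE addrAC; congr (_ - _); rewrite !summxE -big_split /=.
  apply: eq_bigr => i _.
  by rewrite /u mulmxBr [X in _ + X]mxE [X in _ + (_ + X)]mxE addrC subrK.
apply: (@le_trans _ _ (#|J|%:R * M)); last first.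
  by rewrite /rho mxE ler_wpM2r // ler_nat.
rewrite -[leRHS]add0r; apply: lerD; first exact: xfeas.
rewrite mulr_natl -sumr_const [leRHS]big_mkcond; apply: ler_sum => i _.
case: ifPn => [|iJ].
  rewrite inE => /andP[ik _].
  apply: (@le_trans _ _ (spread H X k i)); last exact: (le_bigmax_cond _ _ ik).
  have e v : (H i *m v) k 0 = dot (row k (H i))^T v.
    by rewrite /dot trmxK -row_mul [RHS]mxE.
  rewrite e /u dotBr /spread.
  have -> : (fun v => (H i *m v) k 0) = dot (row k (H i))^T by exact/funext.
  by apply: (dot_diff_le_spread (VX i)) => //; exact: (ymin i).1.
have [Hk|Hk] := eqVneq (row k (H i)) 0.
  have -> : (H i *m u i) k 0 = row k (H i *m u i) 0 0 by rewrite [RHS]mxE.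
  by rewrite row_mul Hk mul0mx mxE.
move: iJ; rewrite inE /coupled inE Hk /= negbK => /eqP ->.
by rewrite mulmx0 mxE.
Qed.

End Duality.

(** * Feasibility of the selections *)

Theorem theorem3p4 (R : realType) (I : finType) (m : nat)
    (r z p : I -> nat)
    (c : forall i, 'cV[R]_(r i + z i))
    (H : forall i, 'M[R]_(m, r i + z i))
    (A : forall i, 'M[R]_(p i, r i + z i))
    (d : forall i, 'cV[R]_(p i))
    (b : 'cV[R]_m) :
  let X := fun i : I => mixed_int_polyhedron (A i) (d i) in
  let bbar := b - rho H X in
  (0 < m)%N -> (m < #|I|)%N ->
  (forall i, X i !=set0) -> (forall i, compact (X i)) ->
  feasible H b X !=set0 ->
  (exists! x, lp_optimal c H X bbar x) ->
  (exists! lambda, dual_optimal c H X bbar lambda) ->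
  forall lambda, dual_optimal c H X bbar lambda ->
  forall x, selections c H X lambda x -> feasible H b X x.
Proof.
move=> X bbar _ _ X0 cX _ [xlp [_ xuniq]] [mu [_ muniq]] lambda lopt x xsel.
have xmin i : argmin (@lagrangian R I m _ c H lambda i) (X i) (x i).
  exact: (xsel i).2.
have VX i := linear_test_set_mixed_int (X0 i) (cX i).
pose V i := sval (cid (VX i)).
have VP i : linear_test_set (V i) (X i) by rewrite /V; case: cid.
have luniq nu : dual_optimal c H X bbar nu -> nu = lambda.
  by move=> /muniq <-; exact: muniq.
have lpuniq w w' :
    lp_optimal c H X bbar w -> lp_optimal c H X bbar w' -> w = w'.
  by move=> /xuniq <- /xuniq.
split=> [i|k]; first exact: (xmin i).1.
have := selection_residual_le VP lopt xmin luniq lpuniq k.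
by rewrite /residual /bbar !mxE; lra.
Qed.
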